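(* Let $\Omega\in\mathcal B(\mathbb R^n)$ and let $C\subset\overline\Omega$ be a density set of $\Omega$. Then the set $\mathrm{Dens}_C$ of all density measures at $C$ on $\Omega$ is a convex and weak$^*$ compact subset of $\mathrm{ba}(\Omega,\mathcal B(\Omega),\mathcal L^n)$.
   Context: $\mathcal L^n$ is Lebesgue measure on $\mathbb R^n$, $\mathcal B(\Omega)$ the Borel subsets of $\Omega$. A measure on $\Omega$ means a finitely additive set function on $\mathcal B(\Omega)$ vanishing at $\emptyset$. $\mathrm{ba}(\Omega,\mathcal B(\Omega),\mathcal L^n)$ is the Banach space of bounded real-valued finitely additive measures $\mu$ on $\mathcal B(\Omega)$ such that $\mu(A)=0$ whenever $\mathcal L^n(A)=0$, with norm $\|\mu\|=|\mu|(\Omega)$ (total variation). It is identified with the dual $L^\infty(\Omega)^*$ of $L^\infty(\Omega)=L^\infty(\Omega,\mathcal B(\Omega),\mathcal L^n)$ via $\langle\mu,f\rangle=\int_\Omega f\,d\mu$ (integral with respect to a finitely additive measure), and weak$^*$ refers to this duality. $C_\delta$ denotes the open $\delta$-neighborhood of $C$ in $\mathbb R^n$. A set $C\subset\overline\Omega$ is a density set of $\Omega$ if $C$ is nonempty and closed in $\mathbb R^n$, $\mathcal L^n(C\cap\Omega)=0$, and $\mathcal L^n(C_\delta\cap\Omega)>0$ for all $\delta>0$. A measure $\mu\in\mathrm{ba}(\Omega,\mathcal B(\Omega),\mathcal L^n)$ is a density measure at $C$ (on $\Omega$) if $\mu\ge 0$ and $\mu(C_\delta\cap\Omega)=\mu(\Omega)=1$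 for all $\delta>0$; $\mathrm{Dens}_C$ is the set of all of these. *)

(* Defs.v *)
From HB Require Import structures.
From mathcomp Require Import all_boot all_order all_algebra.
From mathcomp Require Import all_classical all_reals all_analysis.

Set Implicit Arguments.
Unset Strict Implicit.
Unset Printing Implicit Defensive.

Import Order.TTheory GRing.Theory Num.Theory.
Import numFieldNormedType.Exports HBSimple.

Local Open Scope classical_set_scope.
Local Open Scope ring_scope.

HB.instance Definition _ (R : realType) (n : nat) :=
  Measurable.copy 'rV[R]_n (g_sigma_algebraType (@open 'rV[R]_n)).

Section lebesgue_rV.
Variable R : realType.

Definition consrV n (p : 'rV[R]_n * measurableTypeR R) : 'rV[R]_(1 + n) :=
  row_mx (const_mx p.2) p.1.

Lemma preimage_consrV_ball n (c : 'rV[R]_(1 + n)) (e : R) :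
  @consrV n @^-1` ball c e =
  ball (rsubmx c) e `*` ball (lsubmx c ord0 ord0) e.
Proof.
apply/seteqP; split => -[v x] /=.
  move=> [e0 H]; split; [split=> // i j|].
    by have := H i (rshift 1 j); rewrite /consrV row_mxEr mxE.
  by have := H ord0 (lshift n ord0); rewrite /consrV row_mxEl !mxE.
move=> [[e0 H] Hx]; split=> // i j; rewrite /consrV -(fintype.splitK j).
case: (fintype.split j) => k /=.
  by rewrite row_mxEl mxE !ord1 /=; rewrite mxE !ord1 in Hx.
by rewrite row_mxEr; have := H i k; rewrite mxE.
Qed.

Lemma open_rV_bigcup_ball n (U : set 'rV[R]_n) : open U ->
  U = \bigcup_(p in [set p : 'rV[rat]_n * nat |
                      ball (map_mx ratr p.1 : 'rV[R]_n) p.2.+1%:R^-1 `<=` U])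
        ball (map_mx ratr p.1 : 'rV[R]_n) p.2.+1%:R^-1.
Proof.
move=> oU; apply/seteqP; split => [v Uv|v [p /= + vp]]; last exact.
move: oU; rewrite openE => /(_ _ Uv) /nbhs_ballP[e /= e0 veU].
have [k ke] : exists k : nat, k.+1%:R^-1 < e / 2.
  exists (Num.truncn (e / 2)^-1).
  rewrite invf_plt ?posrE ?divr_gt0 //; exact: Num.Theory.truncnS_gt.
have r0 : 0 < k.+1%:R^-1 :> R by rewrite invr_gt0.
have /choice[q qv] (j : 'I_n) : exists q : rat,
    ball (ratr q : R) k.+1%:R^-1 (v ord0 j).
  have [x [Bx [q _ qx]]] := @dense_rat R (ball (v ord0 j) k.+1%:R^-1)
    (ex_intro _ _ (ballxx _ r0)) (ball_open _ _).
  by exists q; rewrite qx; apply: ball_sym.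
have qvb : ball (map_mx ratr (\row_j q j) : 'rV[R]_n) k.+1%:R^-1 v.
  by split => // i j; rewrite !mxE ord1; exact: qv.
exists (\row_j q j, k) => //= w qw; apply: veU.
rewrite [e]splitr.
have le2 (x y : 'rV[R]_n) : ball x k.+1%:R^-1 y -> ball x (e / 2) y.
  exact: (@le_ball _ 'rV[R]_n _ _ _ (ltW ke)).
by apply: ball_triangle; [apply/ball_sym/le2/qvb | exact: le2].
Qed.

Lemma measurable_consrV n : measurable_fun [set: _] (@consrV n).
Proof.
apply: (@measurability _ _ _ 'rV[R]_(1 + n) _ _ (@open 'rV[R]_(1 + n))) => //.
move=> _ [U oU <-]; rewrite setTI (open_rV_bigcup_ball oU) preimage_bigcup.
rewrite bigcup_mkcond; apply: countable_bigcupT_measurable => // p.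
case: ifP => // _; rewrite preimage_consrV_ball.
apply: measurableX.
  apply: (@sub_sigma_algebra _ setT (@open 'rV[R]_n)).
  exact: (@ball_open R 'rV[R]_n).
exact: measurable_realfun.measurable_ball.
Qed.

Definition lebesgue_rV_succ n (m : {measure set 'rV[R]_n -> \bar R}) :=
  pushforward (m \x lebesgue_measure)%E (@consrV n).


HB.instance Definition _ n (m : {measure set 'rV[R]_n -> \bar R}) :=
  Measure.copy (lebesgue_rV_succ m)
    (@measure_function_pushforward__canonical__measure_function_Measure _ _ _ _ _
      (m \x lebesgue_measure)%E _ (@measurable_consrV n)).

(* L^n as an n-fold product of one-dimensional Lebesgue measures, transported
   along (v, x) |-> (x, v); L^0 is the Dirac mass on the one-point space. *)
Fixpoint lebesgue_rV n : {measure set 'rV[R]_n -> \bar R} :=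
  match n with 0 => \d_(0 : 'rV[R]_0) | n.+1 => lebesgue_rV_succ (lebesgue_rV n) end.
End lebesgue_rV.

Section ba.
Variables (R : realType) (n : nat).
Implicit Types (Omega : set 'rV[R]_n) (mu : set 'rV[R]_n -> R).

(* Set functions are total; values off B(Omega) are normalised to 0 so that two
   elements of ba(Omega) are equal iff they agree on B(Omega). *)
Record ba_axiom Omega mu : Prop := {
  ba_off : forall A, ~ (measurable A /\ A `<=` Omega) -> mu A = 0 ;
  ba_set0 : mu set0 = 0 ;
  ba_additive : forall A B,
    measurable A -> A `<=` Omega -> measurable B -> B `<=` Omega ->
    A `&` B = set0 -> mu (A `|` B) = mu A + mu B ;
  ba_bounded : exists M, forall A, measurable A -> A `<=` Omega -> `|mu A| <= M ;
  ba_null : forall A, measurable A -> A `<=` Omega ->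
    lebesgue_rV R n A = 0%E -> mu A = 0 }.

Definition ba_pred Omega : {pred set 'rV[R]_n -> R} := mem [set mu | ba_axiom Omega mu].

Record ba Omega := BA {
  ba_val :> set 'rV[R]_n -> R ;
  ba_valP : ba_val \in ba_pred Omega }.

HB.instance Definition _ Omega := [isSub for @ba_val Omega].
HB.instance Definition _ Omega := [Choice of ba Omega by <:].

Fact ba_submod_closed Omega : submod_closed (ba_pred Omega).
Proof.
split=> [|k mu nu]; rewrite !inE.
  by split=> //= *; rewrite ?addr0//; exists 0 => *; rewrite normr0.
move=> [muN mu0 muD [M muM] mun] [nuN nu0 nuD [N nuN'] nun].
have E A : (k *: mu + nu) A = k * mu A + nu A by [].
split=> /=.
- by move=> A HA; rewrite E muN// nuN// mulr0 addr0.
- by rewrite E mu0 nu0 mulr0 addr0.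
- by move=> A B mA AO mB BO AB; rewrite !E muD// nuD// mulrDr addrACA.
- exists (`|k| * M + N) => A mA AO; rewrite E (le_trans (ler_normD _ _))//.
  by rewrite lerD ?nuN'// normrM ler_wpM2l// muM.
- by move=> A mA AO A0; rewrite E mun// nun// mulr0 addr0.
Qed.

HB.instance Definition _ Omega :=
  GRing.isSubmodClosed.Build R _ (ba_pred Omega) (ba_submod_closed Omega).
HB.instance Definition _ Omega := [SubChoice_isSubLmodule of ba Omega by <:].

Variables (Omega : set 'rV[R]_n) (mOmega : measurable Omega).

(* Functions on Omega are represented by Borel functions on R^n, compared almost
   everywhere with respect to the restriction of Lebesgue measure to Omega. *)
Definition Linfty : Type :=
  LspaceType (mrestr (lebesgue_rV R n) mOmega) (leey 1%E).

Definition Linfty_norm (f : 'rV[R]_n -> R) : \bar R :=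
  Lnorm (mrestr (lebesgue_rV R n) mOmega) +oo%E (EFin \o f).

Definition sfun_integral (mu : ba Omega) (h : {sfun 'rV[R]_n >-> R}) : R :=
  \sum_(y \in range h) y * mu (Omega `&` h @^-1` [set y]).

(* The integral is the extension by L^infty-continuity of its values on simple
   functions. *)
Definition is_ba_integral (mu : ba Omega) (f : 'rV[R]_n -> R) (v : R) : Prop :=
  exists h : {sfun 'rV[R]_n >-> R}^nat,
    (Linfty_norm (f \- h k) @[k --> \oo] --> 0%E) /\
    (sfun_integral mu (h k) @[k --> \oo] --> v).

Definition ba_integral (mu : ba Omega) (f : 'rV[R]_n -> R) : R :=
  get (is_ba_integral mu f).

Definition ba_pairing (mu : ba Omega) : {ptws Linfty -> R} :=
  fun f => ba_integral mu f.

Definition ba_weak_star : Type := initial_topology ba_pairing.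
HB.instance Definition _ := Topological.on ba_weak_star.

End ba.

Section density.
Variables (R : realType) (n : nat).
Implicit Types (Omega C : set 'rV[R]_n).

(* The library norm on 'rV[R]_n is the sup norm. *)
Definition enorm (x : 'rV[R]_n) : R := Num.sqrt (\sum_i x ord0 i ^+ 2).

Definition nbhd C (delta : R) : set 'rV[R]_n :=
  [set x | exists2 c, C c & enorm (x - c) < delta].

Record density_set Omega C : Prop := {
  density_set_sub : C `<=` closure Omega ;
  density_set_neq0 : C !=set0 ;
  density_set_closed : closed C ;
  density_set_null : lebesgue_rV R n (C `&` Omega) = 0%E ;
  density_set_gt0 : forall delta, 0 < delta ->
    (0 < lebesgue_rV R n (nbhd C delta `&` Omega))%E }.

Definition Dens Omega C : set (ba Omega) :=
  [set mu | [/\ forall A, measurable A -> A `<=` Omega -> 0 <= mu A,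
      mu Omega = 1 &
      forall delta, 0 < delta -> mu (nbhd C delta `&` Omega) = 1]].

End density.
Arguments Dens {R n} Omega C _.

(* Main.v *)
Require Import Defs.
From HB Require Import structures.
From mathcomp Require Import finmap.
From mathcomp Require Import all_boot all_order all_algebra.
From mathcomp Require Import all_classical all_reals all_analysis.
From mathcomp Require Import measurable_realfun ess_sup_inf lra.

Set Implicit Arguments.
Unset Strict Implicit.
Unset Printing Implicit Defensive.

Import Order.TTheory GRing.Theory Num.Theory.
Import numFieldNormedType.Exports HBSimple.
Local Open Scope classical_set_scope.
Local Open Scope ring_scope.

(** Convexity is pointwise. For compactness, take an ultrafilter on the set of
    density measures. Every value nu A lies in [0, 1], so it converges along the
    ultrafilter, to a number mu A, for each set A separately
    (setwise_cvg_ultra). The conditions that define an element of ba and a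
    density measure are equalities and non-strict inequalities between finitely
    many values, with uniform bound 1, so they pass to the limit; countable
    additivity would not, which is why finitely additive measures are the right
    setting (setwise_closed_Dens).

    It remains to upgrade setwise convergence to weak* convergence, that is, to
    convergence of the integral of each f in L^infty. For a simple f the integral
    is a finite linear combination of values of the measure. In general f is
    uniformly approximated by simple functions h, and the error is at most the
    essential supremum of |f - h| simultaneously for all the measures involved,
    because they are positive, of total mass 1 and vanish on Lebesgue null sets
    (sfun_integral_lipschitz, ba_integral_sfun_dist). An argument with a third
    of epsilon concludes (cvg_ba_integral).

    The integral is a chosen limit of integrals of simple functions; the same
    Lipschitz estimate shows that such a limit exists and controls every choice
    of it (is_ba_integral_exists). *)

(** * Limits along filters *)

(** A cluster point along an ultrafilter is a limit: either the preimage of a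
    neighbourhood or its complement is in the ultrafilter, and the latter is
    incompatible with clustering. *)
Lemma ultra_cvg_segment (R : realType) (T : Type) (F : set_system T)
    (f : T -> R) (a b : R) :
  UltraFilter F -> F (f @^-1` `[a, b]) -> exists l : R, f @ F --> l.
Proof.
move=> UF Fab.
have [l [_ Gl]] := @segment_compact R a b (f @ F) _ Fab.
exists l => B Bl /=.
have [//|FnB] := in_ultra_setVsetC (f @^-1` B) UF.
by have [x [/= nBx Bx]] := Gl (~` B) B FnB Bl.
Qed.

Lemma cvgr_near_cst_eq (R : realType) (T : Type) (F : set_system T)
    (f : T -> R) (l c : R) : ProperFilter F ->
  f @ F --> l -> (\forall x \near F, f x = c) -> l = c.
Proof.
move=> PF fl fc; apply/eqP; rewrite eq_le; apply/andP; split.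
  by apply: (cvgr_to_le fl); apply: filterS fc => x ->.
by apply: (cvgr_to_ge fl); apply: filterS fc => x ->.
Qed.

(** The weak* topology is the topology induced by a family of functionals, so a
    filter converges in it as soon as every functional converges. *)
Lemma initial_ptws_cvg (S : choiceType) (I : Type) (V : topologicalType)
    (p : S -> {ptws I -> V}) (F : set_system S) (s : S) : Filter F ->
  (forall i, (fun t => p t i) @ F --> p s i) ->
  F --> (s : initial_topology p).
Proof.
move=> FF Fi.
have Fp : p @ F --> p s.
  apply/cvg_sup => i A; rewrite nbhsE => -[_ [[W oW <-] Ws] WA].
  by apply: filterS WA _; apply: Fi; exact: open_nbhs_nbhs.
move=> A; rewrite nbhsE => -[_ [[W oW <-] Ws] WA].
by apply: filterS WA _; apply: Fp; exact: open_nbhs_nbhs.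
Qed.

(** * Uniform approximation by simple functions *)

Section sfun_approx.
Context d (T : measurableType d) (R : realType).

(** Rounding to a grid of mesh e gives a simple approximation once values above M
    are cut off; the rounded value is a monotone function of the original one,
    hence measurable. *)
Lemma bounded_sfun_approx (f : T -> R) (M e : R) :
  measurable_fun setT f -> 0 < e -> exists h : {sfun T >-> R},
  forall x, `|f x| <= M -> `|f x - h x| <= e.
Proof.
move=> mf e0.
(* The shift by M makes the argument of the truncation to nat nonnegative
   wherever |f x| <= M; elsewhere truncation sends negative numbers to 0, so
   that only the cut from above is needed to make the range finite. *)
pose step (t : R) : R := (Num.truncn ((Num.min M t + M) / e))%:R * e - M.
have step_nd : {homo step : x y / x <= y}.
  move=> x y xy; rewrite lerD2r ler_wpM2r ?(ltW e0)// ler_nat le_truncn//.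
  by rewrite ler_wpM2r ?invr_ge0 ?(ltW e0)// lerD2r le_min ge_min lexx ge_min xy orbT.
have mstep : measurable_fun setT (step \o f).
  by apply: measurableT_comp => //; exact: nondecreasing_measurable.
have fstep : finite_set (range (step \o f)).
  apply: (@sub_finite_set _ _ ((fun k : nat => k%:R * e - M) @`
    `I_(Num.truncn ((M + M) / e)).+1)); last exact/finite_image/finite_II.
  move=> _ [x _ <-]; exists (Num.truncn ((Num.min M (f x) + M) / e)) => //=.
  rewrite ltnS le_truncn// ler_wpM2r ?invr_ge0 ?(ltW e0)//.
  by rewrite lerD2r ge_min lexx.
have sstep : step \o f \in sfun by apply/andP; rewrite !inE.
exists (sfun_Sub sstep) => x; rewrite ler_norml => /andP[Mf fM].
have fM0 : 0 <= (f x + M) / e.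
  by rewrite divr_ge0 ?(ltW e0)// -lerBlDr sub0r.
rewrite /= /step min_r//.
move: (truncn_itv fM0); set k := Num.truncn _ => /andP[].
rewrite ler_pdivlMr// ltr_pdivrMr// -natr1 mulrDl mul1r => lo hi.
rewrite opprB addrA ler_norml; apply/andP; split; lra.
Qed.
End sfun_approx.

(** * Positive charges of total mass 1 and integrals of simple functions *)

Section positive_charges.
Variables (R : realType) (n : nat) (Omega : set 'rV[R]_n).
Implicit Types (mu : ba Omega) (A B : set 'rV[R]_n) (h g : {sfun 'rV[R]_n >-> R}).

Definition probability_charge mu :=
  (forall A, measurable A -> A `<=` Omega -> 0 <= mu A) /\ mu Omega = 1.

Lemma baP mu : ba_axiom Omega mu.
Proof. by have := ba_valP mu; rewrite inE. Qed.

Lemma probability_charge01 mu A : measurable Omega ->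
  probability_charge mu -> 0 <= mu A <= 1.
Proof.
move=> mO [mu0 mu1].
have [[mA AO]|nA] := pselect (measurable A /\ A `<=` Omega); last first.
  by rewrite (ba_off (baP mu) nA) lexx ler01.
have mOA : measurable (Omega `\` A) by exact: measurableD.
have OAO : Omega `\` A `<=` Omega by move=> x [].
rewrite mu0//=; have <- : mu A + mu (Omega `\` A) = 1.
  by rewrite -(ba_additive (baP mu)) ?setDUK//; exact: setDIK.
by rewrite lerDl mu0.
Qed.

Lemma sfun_preimage_measurable h (B : set R) : measurable (h @^-1` B).
Proof.
suff -> : h @^-1` B = h @^-1` (B `&` range h).
  rewrite -[X in measurable X]setTI; apply: (measurable_funP h) => //.
  apply: countable_measurable => [t|]; first exact: measurable_set1.
  apply: finite_set_countable.
  by apply: (@sub_finite_set _ _ (range h)) => // x [].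
by apply/seteqP; split=> x /=; [split=> //; exists x|case].
Qed.

Lemma ba_preimage_seq mu A h (s : seq R) : uniq s ->
  measurable A -> A `<=` Omega ->
  mu (A `&` h @^-1` [set` s]) = \sum_(y <- s) mu (A `&` h @^-1` [set y]).
Proof.
move=> + mA AO; elim: s => [_|y s IH /= /andP[ys us]].
  by rewrite big_nil set_nil preimage_set0 setI0 (ba_set0 (baP mu)).
have mAh (B : set R) : measurable (A `&` h @^-1` B).
  by apply: measurableI => //; exact: sfun_preimage_measurable.
have AhO (B : set R) : A `&` h @^-1` B `<=` Omega by move=> x [] /AO.
rewrite big_cons -IH// -(ba_additive (baP mu))//.
  rewrite -setIUr -preimage_setU; congr (mu (_ `&` _ @^-1` _)).
  apply/seteqP; split=> x /=; rewrite inE; first by case/predU1P; [left|right].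
  by case=> [->|->]; rewrite ?eqxx ?orbT.
rewrite setIACA setIid -preimage_setI (_ : [set y] `&` _ = set0).
  by rewrite preimage_set0 setI0.
by apply/seteqP; split=> // x /= [->]; rewrite (negbTE ys).
Qed.

Lemma ba_preimage_range mu A h : measurable A -> A `<=` Omega ->
  mu A = \sum_(y <- fset_set (range h)) mu (A `&` h @^-1` [set y]).
Proof.
move=> mA AO; rewrite -ba_preimage_seq ?fset_uniq//.
congr (mu _); apply/seteqP; split=> x /=; last by case.
by split=> //; rewrite in_fset_set// inE; exists x.
Qed.

Hypothesis mOmega : measurable Omega.

(** Two simple functions can be compared only over the common refinement of their
    level sets. *)
Lemma sfun_integral_refine mu h g : sfun_integral mu h =
  \sum_(y <- fset_set (range h)) \sum_(z <- fset_set (range g))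
    y * mu (Omega `&` h @^-1` [set y] `&` g @^-1` [set z]).
Proof.
rewrite /sfun_integral fsbig_finite//=; apply: eq_bigr => y _.
by rewrite -mulr_sumr -ba_preimage_range.
Qed.

Let leb := mrestr (lebesgue_rV R n) mOmega.

(** On a cell of the common refinement with nonzero mass both functions are
    constant. Such a cell is not Lebesgue null, hence contains a point outside the
    exceptional set, and the two constants differ by at most c. Summing c times
    the masses gives c because the total mass is 1. *)
Lemma sfun_integral_lipschitz mu h g (c : R) : probability_charge mu ->
  (\forall x \ae leb, `|h x - g x| <= c) ->
  `|sfun_integral mu h - sfun_integral mu g| <= c.
Proof.
move=> [mu0 mu1] [N [mN N0 cN]].
have mI y z : measurable (Omega `&` h @^-1` [set y] `&` g @^-1` [set z]).
  by do 2?apply: measurableI => //; exact: sfun_preimage_measurable.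
have IO y z : Omega `&` h @^-1` [set y] `&` g @^-1` [set z] `<=` Omega.
  by move=> x [[]].
rewrite (sfun_integral_refine mu h g) (sfun_integral_refine mu g h).
rewrite [X in _ - X]exchange_big/= -sumrB.
rewrite -[leRHS]mulr1 -mu1 (ba_preimage_range mu h)// mulr_sumr.
apply: le_trans (ler_norm_sum _ _ _) _; apply: ler_sum => y _.
rewrite (ba_preimage_range mu g); first last.
- by move=> x [].
- by apply: measurableI => //; exact: sfun_preimage_measurable.
rewrite mulr_sumr -sumrB.
apply: le_trans (ler_norm_sum _ _ _) _; apply: ler_sum => z _.
rewrite (setIAC Omega (g @^-1` _)) -mulrBl normrM (ger0_norm (mu0 _ _ _))//.
have [->|mun0] := eqVneq (mu (Omega `&` h @^-1` [set y] `&` g @^-1` [set z])) 0.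
  by rewrite !mulr0.
rewrite ler_wpM2r ?mu0//.
(* A cell inside the exceptional null set would have mass 0. *)
have [x [[[Ox /= <-] /= <-]] Nx] :
    exists x, (Omega `&` h @^-1` [set y] `&` g @^-1` [set z]) x /\ ~ N x.
  apply: contrapT => /forallNP H; move/eqP: mun0; apply.
  apply: (ba_null (baP mu)) => //.
  apply/eqP; rewrite eq_le measure_ge0 andbT -N0.
  apply: le_measure; rewrite ?inE//; first exact: measurableI.
  by move=> x xI; split; [apply: contrapT => Nx; exact: (H x)|exact: IO xI].
by apply: contrapT => H; apply/Nx/cN.
Qed.

End positive_charges.
Arguments probability_charge {R n Omega} mu.

(** * Integrals of essentially bounded functions *)

Section integral.
Variables (R : realType) (n : nat) (Omega : set 'rV[R]_n).
Variable mOmega : measurable Omega.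
Implicit Types (mu : ba Omega) (h g : {sfun 'rV[R]_n >-> R}).
Implicit Types (f : 'rV[R]_n -> R).

Let leb := mrestr (lebesgue_rV R n) mOmega.

(** Needed because the essential supremum norm is 0 by convention on a space of
    measure 0, where it would say nothing about f. *)
Lemma probability_charge_leb_gt0 mu : probability_charge mu ->
  (0 < leb setT)%E.
Proof.
move=> [_ mu1]; rewrite lt_neqAle measure_ge0 andbT eq_sym.
apply/eqP; rewrite /leb /mrestr setTI => leb0.
have := ba_null (baP mu) mOmega (@subset_refl _ _) leb0.
by rewrite mu1 => /eqP; rewrite oner_eq0.
Qed.

Lemma Linfty_norm_leP f (c : R) : (0 < leb setT)%E ->
  (Linfty_norm mOmega f <= c%:E)%E <-> \forall x \ae leb, `|f x| <= c.
Proof.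
move=> leb0; rewrite /Linfty_norm unlock leb0; split.
  by move/ess_supP; apply: filterS => x /=; rewrite lee_fin.
by move=> fc; apply/ess_supP; apply: filterS fc => x /=; rewrite lee_fin.
Qed.

Lemma Linfty_sfun_approx f (e : R) : (0 < leb setT)%E ->
  measurable_fun setT f -> (Linfty_norm mOmega f < +oo)%E -> 0 < e ->
  exists h, (Linfty_norm mOmega (f \- h)%R <= e%:E)%E.
Proof.
move=> leb0 mf foo e0.
have [M fM] : exists M, (Linfty_norm mOmega f <= M%:E)%E.
  exists (fine (Linfty_norm mOmega f)).
  by rewrite fineK// ge0_fin_numE ?Lnorm_ge0.
have [h fh] := bounded_sfun_approx M mf e0.
by exists h; apply/Linfty_norm_leP => //;
   apply: filterS ((Linfty_norm_leP _ _ leb0).1 fM).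
Qed.

Lemma sfun_integral_Linfty_dist mu f h g (a b : R) : probability_charge mu ->
  (Linfty_norm mOmega (f \- h)%R <= a%:E)%E ->
  (Linfty_norm mOmega (f \- g)%R <= b%:E)%E ->
  `|sfun_integral mu h - sfun_integral mu g| <= a + b.
Proof.
move=> pmu; have leb0 := probability_charge_leb_gt0 pmu.
move=> /(Linfty_norm_leP _ _ leb0) fh /(Linfty_norm_leP _ _ leb0) fg.
apply: (@sfun_integral_lipschitz _ _ _ mOmega) => //.
apply: filterS2 fh fg => x /= fh fg.
have -> : h x - g x = (f x - g x) - (f x - h x) by lra.
by rewrite (le_trans (ler_normB _ _))// addrC lerD.
Qed.

(** The Lipschitz estimate makes the integrals of any sequence of simple functions
    that converges in L^infty a Cauchy sequence. *)
Lemma is_ba_integral_exists mu f : probability_charge mu ->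
  measurable_fun setT f -> (Linfty_norm mOmega f < +oo)%E ->
  exists v, is_ba_integral mOmega mu f v.
Proof.
move=> pmu mf foo; have leb0 := probability_charge_leb_gt0 pmu.
have /choice[h fh] (k : nat) :
    exists h, (Linfty_norm mOmega (f \- h)%R <= (k.+1%:R^-1)%:E)%E.
  by apply: Linfty_sfun_approx => //; rewrite invr_gt0.
have : cvgn (fun k => sfun_integral mu (h k)).
  apply: cauchy_cvg; apply: cauchy_exP => e e0.
  have e20 : 0 < e / 2 by rewrite divr_gt0.
  have [N _ NE] := near_infty_natSinv_lt (PosNum e20).
  exists (sfun_integral mu (h N)); exists N => // k /= Nk.
  apply: le_lt_trans (sfun_integral_Linfty_dist pmu (fh N) (fh k)) _.
  by rewrite [e]splitr ltrD ?NE/=.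
move=> /cvg_ex[v hv]; exists v, h; split => //.
apply: (@squeeze_cvge _ _ _ _ (cst 0%E) _ (fun k => (k.+1%:R^-1)%:E)).
- by apply: nearW => k /=; rewrite Lnorm_ge0 fh.
- exact: cvg_cst.
- by apply: cvg_EFin; [exact: nearW|exact: cvg_harmonic].
Qed.

(** This holds for whichever value the choice operator picks as the integral: any
    admissible value is a limit of integrals of simple functions g k, each of
    which obeys the Lipschitz estimate against h. *)
Lemma ba_integral_sfun_dist mu f h (c : R) : probability_charge mu ->
  measurable_fun setT f -> (Linfty_norm mOmega f < +oo)%E ->
  (Linfty_norm mOmega (f \- h)%R <= c%:E)%E ->
  `|ba_integral mOmega mu f - sfun_integral mu h| <= c.
Proof.
move=> pmu mf foo fh.
have /getPex[g [fg gv]] := is_ba_integral_exists pmu mf foo.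
rewrite -/(ba_integral mOmega mu f) in gv.
(* It suffices to bound the terms by c + e, which holds once g k is e-close to f. *)
apply/ler_addgt0Pl => e e0.
have gv' : `|sfun_integral mu (g k) - sfun_integral mu h| @[k --> \oo] -->
    `|ba_integral mOmega mu f - sfun_integral mu h|.
  by apply: cvg_norm; apply: cvgB => //; exact: cvg_cst.
apply: (cvgr_to_le gv').
have : \forall k \near \oo, (Linfty_norm mOmega (f \- g k)%R < e%:E)%E.
  by apply: (fg [set u | (u < e%:E)%E]); apply: open_ereal_lt'; rewrite lte_fin.
apply: filterS => k /ltW fgk.
exact: sfun_integral_Linfty_dist fgk fh.
Qed.

End integral.

(** * From setwise to weak* convergence, and compactness *)

Section setwise_limits.
Variables (R : realType) (n : nat) (Omega : set 'rV[R]_n).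
Variable mOmega : measurable Omega.
Implicit Types (mu nu : ba Omega) (F : set_system (ba Omega)).

Definition setwise_cvg F mu := forall A, (fun nu : ba Omega => nu A) @ F --> mu A.

(** The limits of the values at different sets are taken independently; finite
    additivity survives because it relates three values only. *)
Lemma setwise_cvg_ultra F : UltraFilter F -> F probability_charge ->
  exists mu, setwise_cvg F mu.
Proof.
move=> UF Fp.
have /choice[l Fl] (A : set 'rV[R]_n) : exists l : R,
    (fun nu : ba Omega => nu A) @ F --> l.
  apply: (@ultra_cvg_segment _ _ _ _ 0 1 UF); apply: filterS Fp => nu pnu.
  by rewrite /= in_itv/= probability_charge01.
have l_cst A c : (forall nu, nu A = c) -> l A = c.
  by move=> Ac; apply: (cvgr_near_cst_eq _ (Fl A)); exact: nearW.
suff lba : ba_axiom Omega l.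
  have lP : l \in ba_pred Omega by rewrite inE.
  by exists (BA lP).
split.
- by move=> A nA; apply: l_cst => nu; exact: ba_off (baP nu) _ nA.
- by apply: l_cst => nu; exact: ba_set0 (baP nu).
- move=> A B mA AO mB BO AB.
  apply: subr0_eq.
  apply: (cvgr_near_cst_eq _ (cvgB (Fl (A `|` B)) (cvgD (Fl A) (Fl B)))).
  apply: nearW => nu; rewrite -[LHS]/(nu (A `|` B) - (nu A + nu B)).
  by rewrite (ba_additive (baP nu))// subrr.
- exists 1 => A mA AO; rewrite ler_norml; apply/andP; split.
    apply: (cvgr_to_ge (Fl A)); apply: filterS Fp => nu pnu.
    have /andP[nu0 _] := probability_charge01 A mOmega pnu.
    by rewrite (le_trans _ nu0)// lerN10.
  apply: (cvgr_to_le (Fl A)); apply: filterS Fp => nu pnu.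
  by have /andP[] := probability_charge01 A mOmega pnu.
- by move=> A mA AO A0; apply: l_cst => nu; exact: ba_null (baP nu) _ mA AO A0.
Qed.

Lemma Dens_probability (C : set 'rV[R]_n) : Dens Omega C `<=` probability_charge.
Proof. by move=> mu []. Qed.

Lemma setwise_closed_Dens (C : set 'rV[R]_n) F mu : ProperFilter F ->
  F (Dens Omega C) -> setwise_cvg F mu -> Dens Omega C mu.
Proof.
move=> PF FD Fmu.
have mu_cst A c : (forall nu, Dens Omega C nu -> nu A = c) -> mu A = c.
  by move=> Ac; apply: (cvgr_near_cst_eq _ (Fmu A)); exact: filterS FD.
split.
- move=> A mA AO; apply: (cvgr_to_ge (Fmu A)).
  by apply: filterS FD => nu [+ _ _]; exact.
- by apply: mu_cst => nu [].
- by move=> d d0; apply: mu_cst => nu [_ _]; exact.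
Qed.

Lemma cvg_sfun_integral F mu (h : {sfun 'rV[R]_n >-> R}) : Filter F ->
  setwise_cvg F mu ->
  (fun nu : ba Omega => sfun_integral nu h) @ F --> sfun_integral mu h.
Proof.
move=> FF Fmu; rewrite /sfun_integral.
under eq_fun do rewrite fsbig_finite//=.
rewrite fsbig_finite//=.
apply: cvg_big => [|y _]; first exact: add_continuous.
apply: cvgM => //; exact: cvg_cst.
Qed.

(** The simple function h is chosen once from f and serves mu and all nu near the
    limit alike, since the error bound depends on neither. *)
Lemma cvg_ba_integral F mu (f : 'rV[R]_n -> R) : ProperFilter F ->
  F probability_charge -> probability_charge mu -> setwise_cvg F mu ->
  measurable_fun setT f -> (Linfty_norm mOmega f < +oo)%E ->
  (fun nu : ba Omega => ba_integral mOmega nu f) @ F --> ba_integral mOmega mu f.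
Proof.
move=> PF Fp pmu Fmu mf foo.
have leb0 := probability_charge_leb_gt0 mOmega pmu.
apply/cvgrPdist_lt => e e0.
have e30 : 0 < e / 3 by rewrite divr_gt0.
have [h fh] := Linfty_sfun_approx leb0 mf foo e30.
have muh := ba_integral_sfun_dist pmu mf foo fh.
have hF : (fun nu : ba Omega => sfun_integral nu h) @ F --> sfun_integral mu h.
  exact: cvg_sfun_integral.
near=> nu.
have pnu : probability_charge nu by near: nu.
have : `|sfun_integral mu h - sfun_integral nu h| < e / 3.
  by near: nu; move/cvgrPdist_lt : hF; exact.
have := ba_integral_sfun_dist pnu mf foo fh.
move: muh; rewrite !ler_norml !ltr_norml => /andP[? ?] /andP[? ?] /andP[? ?].
by apply/andP; split; lra.
Unshelve. all: by end_near. Qed.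

Lemma setwise_weak_star_cvg F mu : ProperFilter F ->
  F probability_charge -> probability_charge mu -> setwise_cvg F mu ->
  (F : set_system (ba_weak_star mOmega)) --> (mu : ba_weak_star mOmega).
Proof.
move=> PF Fp pmu Fmu.
apply: initial_ptws_cvg => f.
apply: cvg_ba_integral => //; last exact: (@Lebesgue_finite _ _ _ _ _ _ f).
rewrite /aqEqMfun_to_fun; set g := generic_quotient.repr _.
exact: (measurable_funP g).
Qed.

End setwise_limits.

Lemma convex_Dens (R : realType) (n : nat) (Omega C : set 'rV[R]_n) :
  convex_set (Dens Omega C).
Proof.
move=> mu nu t; rewrite !inE => -[mu0 mu1 muC] [nu0 nu1 nuC].
have E A : (conv t mu nu : ba Omega) A =
    t%:num * mu A + (1 - t%:num) * nu A by [].
split.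
- by move=> A mA AO; rewrite E addr_ge0// mulr_ge0 ?mu0 ?nu0.
- by rewrite E mu1 nu1 !mulr1 subrKC.
- by move=> d d0; rewrite E muC// nuC// !mulr1 subrKC.
Qed.

Theorem theorem3p2 (R : realType) (n : nat) (Omega C : set 'rV[R]_n)
  (mOmega : measurable Omega) (hC : density_set Omega C) :
  convex_set (Dens Omega C) /\
  compact (Dens Omega C : set (ba_weak_star mOmega)).
Proof.
split; first exact: convex_Dens.
rewrite compact_ultra => F UF FD.
have Fp : F probability_charge by apply: filterS FD; exact: Dens_probability.
have [mu Fmu] := setwise_cvg_ultra mOmega UF Fp.
have Dmu : Dens Omega C mu by exact: setwise_closed_Dens FD Fmu.
exists mu; split => //.
exact: setwise_weak_star_cvg Fp (Dens_probability Dmu) Fmu.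
Qed.
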